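(* Let $g$ be the function on positive integers defined by $g(1)=0$ and $g(\Delta)=2^{g(\Delta-1)+\Delta-2}+g(\Delta-1)$ for $\Delta\ge2$, and for a nonnegative integer $h$ let $g^{-1}(h)=\min\{\Delta : g(\Delta)\ge h\}$. Then for every $h\ge0$ the reversible (persistent) pebbling price of the pyramid of height $h$, as well as of the complete binary tree of height $h$, is $h+g^{-1}(h)$; moreover $g^{-1}$ is efficiently computable.
   Context: All graphs are finite DAGs; $\mathrm{pred}(v)$ is the set of immediate predecessors of $v$. A reversible pebbling is a sequence of vertex sets $P_0,\dots,P_\tau$, each obtained from the previous by placing a pebble on some $v\notin P$ with $\mathrm{pred}(v)\subseteq P$, or removing a pebble from some $v\in P$ with $\mathrm{pred}(v)\subseteq P$; its space is $\max_t|P_t|$. The persistent (reversible) pebbling price of a DAG with unique sink $z$ is the minimum space of a reversible pebbling with $P_0=\emptyset$, $P_\tau=\{z\}$. The pyramid of height $h$ has vertices $(i,j)$ for $0\le i\le j\le h$; sources are $(0,j)$, the sink is $(h,h)$, and for $i<h$ vertex $(i,j)$ has an edge to $(i+1,j)$ if $j>i$ and an edge to $(i+1,j+1)$ if $j<h$. The complete binary tree of height $h$ has all edges directed from leaves towards the root (the root is the sink; leaves at depth $h$ are sources). *)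

(* Defs.v *)
From mathcomp Require Import all_boot.

Set Implicit Arguments.
Unset Strict Implicit.
Unset Printing Implicit Defensive.

(* [g] is only meaningful on positive integers; [g 0 = 0] is a dummy value,
   which [ginv] never looks at. *)
Fixpoint g (D : nat) : nat :=
  match D with
  | 0 => 0
  | D'.+1 => if D' is 0 then 0 else 2 ^ (g D' + D - 2) + g D'
  end.

Lemma g_unbounded (h : nat) : exists D, (0 < D) && (h <= g D).
Proof.
exists h.+1; rewrite /=; elim: h => // h IHh.
rewrite -[h.+1]add1n leq_add //; first by rewrite expn_gt0.
Qed.

Definition ginv (h : nat) : nat := ex_minn (g_unbounded h).

Record dag : Type := Dag {
  vertex :> finType;
  edge : rel vertex;
  sink : vertex;
  dag_acyclic : forall c : seq vertex, cycle edge c -> c = [::];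
  dag_sinkP : forall v : vertex, (forall w, ~~ edge v w) <-> v = sink
}.

Section Pebbling.

Variable G : dag.

Definition preds (v : G) : {set G} := [set u | edge u v].

Definition pebble_move (P Q : {set G}) : bool :=
  [exists v : G, (preds v \subset P) &&
     (((v \notin P) && (Q == v |: P)) || ((v \in P) && (Q == P :\ v)))].

(* A sequence P_0, ..., P_tau of configurations is given by its first element
   P_0 and the list s of the remaining ones. *)
Definition reversible_pebbling (P0 : {set G}) (s : seq {set G}) : bool :=
  path pebble_move P0 s.

Definition pebbling_space (P0 : {set G}) (s : seq {set G}) : nat :=
  \max_(P <- P0 :: s) #|P|.

Definition persistent_pebbling (s : seq {set G}) : bool :=
  reversible_pebbling set0 s && (last set0 s == [set sink G]).

Definition persistent_price_is (n : nat) : Prop :=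
  (exists2 s, persistent_pebbling s & pebbling_space set0 s = n) /\
  (forall s, persistent_pebbling s -> n <= pebbling_space set0 s).

End Pebbling.

Lemma ranked_acyclic (T : eqType) (e : rel T) (r : T -> nat) :
  (forall u v, e u v -> r u < r v) -> forall c, cycle e c -> c = [::].
Proof.
move=> er [|x p] //= xp; have {xp} : path (relpre r ltn) x (rcons p x).
  by apply: sub_path xp => u v /er.
rewrite path_sortedE; last by move=> y u v /= uy yv; apply: ltn_trans yv.
by case/andP=> /allP/(_ x); rewrite mem_rcons mem_head /= ltnn => /(_ isT).
Qed.

Section Pyramid.

Variable h : nat.

Definition pyramid_vertex : finType :=
  {p : 'I_h.+1 * 'I_h.+1 | p.1 <= p.2}.

Definition pyr_i (v : pyramid_vertex) : nat := (sval v).1.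
Definition pyr_j (v : pyramid_vertex) : nat := (sval v).2.

Definition pyramid_edge (u v : pyramid_vertex) : bool :=
  (pyr_i u < h) &&
  [|| (pyr_i u < pyr_j u) &&
      ((pyr_i v == (pyr_i u).+1) && (pyr_j v == pyr_j u))
    | (pyr_j u < h) &&
      ((pyr_i v == (pyr_i u).+1) && (pyr_j v == (pyr_j u).+1))].

Definition pyramid_sink : pyramid_vertex :=
  exist _ (ord_max, ord_max) (leqnn h).

Lemma pyramid_acyclic (c : seq pyramid_vertex) :
  cycle pyramid_edge c -> c = [::].
Proof.
apply: (@ranked_acyclic _ _ pyr_i) => u v /andP[_].
by case/orP=> /and3P[_ /eqP-> _].
Qed.

Lemma pyramid_sinkP (v : pyramid_vertex) :
  (forall w, ~~ pyramid_edge v w) <-> v = pyramid_sink.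
Proof.
split=> [noedge | -> w]; last by rewrite /pyramid_edge /pyr_i /= ltnn.
have leij : pyr_i v <= pyr_j v := valP v.
have lejh : pyr_j v <= h by rewrite -ltnS ltn_ord.
have [lt_ih | le_hi] := ltnP (pyr_i v) h; last first.
  have jh : pyr_j v = h.
    by apply/eqP; rewrite eqn_leq lejh (leq_trans le_hi leij).
  have ih : pyr_i v = h by apply/eqP; rewrite eqn_leq le_hi (leq_trans leij).
  by apply/val_inj/eqP/andP; split; apply/eqP/val_inj; [apply: ih | apply: jh].
have ltS : (pyr_i v).+1 < h.+1 by [].
have [lt_ij | le_ji] := ltnP (pyr_i v) (pyr_j v).
  pose w : pyramid_vertex :=
    exist _ (Ordinal ltS, (val v).2) lt_ij.
  by have := noedge w; rewrite /pyramid_edge lt_ih lt_ij /w /pyr_i /pyr_j /= !eqxx.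
have eji : pyr_j v = pyr_i v by apply/eqP; rewrite eqn_leq le_ji.
pose w : pyramid_vertex := exist _ (Ordinal ltS, Ordinal ltS) (leqnn _).
have := noedge w.
rewrite /pyramid_edge lt_ih eji lt_ih /w /= {1 3}/pyr_i {2}/pyr_j /=.
by rewrite !eqxx orbT.
Qed.

Definition pyramid : dag := Dag pyramid_acyclic pyramid_sinkP.

End Pyramid.

Section BinaryTree.

Variable h : nat.

(* A vertex at depth d is the length-d word of left/right choices on the path
   between it and the root, the choice nearest to the root coming last; hence
   the children of v are [false :: v] and [true :: v]. *)
Definition tree_edge (u v : h.-bseq bool) : bool :=
  [exists b : bool, (u : seq bool) == b :: v].

Definition tree_root : h.-bseq bool := [bseq].

Lemma tree_acyclic (c : seq (h.-bseq bool)) : cycle tree_edge c -> c = [::].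
Proof.
apply: (@ranked_acyclic _ _ (fun u : h.-bseq bool => h - size u)) => u v.
case/existsP=> b /eqP uE; apply: ltn_sub2l; last by rewrite uE /=.
by have := size_bseq u; rewrite uE.
Qed.

Lemma tree_sinkP (v : h.-bseq bool) :
  (forall w, ~~ tree_edge v w) <-> v = tree_root.
Proof.
split=> [noedge | -> w]; last by apply/existsPn.
apply: val_inj; case: v noedge => -[|b s] //= ltsh noedge.
have := noedge (Bseq (ltnW ltsh)).
by case/existsP; exists b; rewrite /= eqxx.
Qed.

Definition binary_tree : dag := Dag tree_acyclic tree_sinkP.

End BinaryTree.

Variant direction : Type := Left | Stay | Right.

Section Tape.

(* Tape symbols: [None] is the blank, [Some (inl b)] the bit b, and
   [Some (inr x)] a further work symbol. *)
Variable X : finType.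

Definition symbol : finType := option (bool + X)%type.

(* A two-way infinite tape: the scanned cell, the cells to its left (nearest
   first) and those to its right, all blank beyond the listed ones. *)
Record tape : Type := Tape {
  tape_left : seq symbol;
  tape_head : symbol;
  tape_right : seq symbol
}.

Definition blank_tape : tape := Tape [::] None [::].

Definition tape_write (x : symbol) (t : tape) : tape :=
  Tape (tape_left t) x (tape_right t).

Definition tape_move (d : direction) (t : tape) : tape :=
  let: Tape l x r := t in
  match d with
  | Left => Tape (behead l) (head None l) (x :: r)
  | Stay => t
  | Right => Tape (x :: l) (head None r) (behead r)
  end.

Definition input_tape (w : seq bool) : tape :=
  let s := [seq Some (inl b) | b <- w] in
  Tape [::] (head None s) (behead s).

Fixpoint leading_bits (s : seq symbol) : seq bool :=
  if s is Some (inl b) :: s' then b :: leading_bits s' else [::].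

Definition tape_output (t : tape) : seq bool :=
  leading_bits (tape_head t :: tape_right t).

End Tape.

(* Deterministic Turing machines with [tm_tapes.+1] tapes; tape [ord0] is both
   the input and the output tape. *)
Record turing_machine : Type := TuringMachine {
  tm_tapes : nat;
  tm_work : finType;
  tm_state : finType;
  tm_start : tm_state;
  tm_halt : pred tm_state;
  tm_delta : tm_state -> {ffun 'I_tm_tapes.+1 -> symbol tm_work} ->
             tm_state * {ffun 'I_tm_tapes.+1 -> symbol tm_work * direction}
}.

Section Run.

Variable M : turing_machine.

Definition config : Type :=
  (tm_state M * {ffun 'I_(tm_tapes M).+1 -> tape (tm_work M)})%type.

Definition initial_config (w : seq bool) : config :=
  (tm_start M,
   [ffun i => if i == ord0 then input_tape (tm_work M) w
              else blank_tape (tm_work M)]).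

Definition tm_step (c : config) : config :=
  if tm_halt c.1 then c else
  let: (q, act) := tm_delta c.1 [ffun i => tape_head (c.2 i)] in
  (q, [ffun i => tape_move (act i).2 (tape_write (act i).1 (c.2 i))]).

Definition tm_computes_within (w w' : seq bool) (t : nat) : Prop :=
  let c := iter t tm_step (initial_config w) in
  tm_halt c.1 /\ tape_output (c.2 ord0) = w'.

End Run.

(* Binary representation without leading zeros, least significant bit first;
   [up_log 2 n.+1] is the bit length of n, so 0 is the empty word. *)
Definition binary (n : nat) : seq bool :=
  mkseq (fun i => odd (n %/ 2 ^ i)) (up_log 2 n.+1).

Definition polytime_computable (f : nat -> nat) : Prop :=
  exists (M : turing_machine) (a d : nat), forall n : nat,
    tm_computes_within M (binary n) (binary (f n))
      (a * size (binary n) ^ d + a).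

(* Main.v *)
From HB Require Import structures.
Require Import Defs.
From mathcomp Require Import all_boot zify.

(** The persistent price equals the value of the Dymond-Tompa game: the pebbler
    puts pebbles down one at a time, the challenger, who starts on the sink,
    either stays or jumps to the new pebble, and the game ends when all
    predecessors of the challenged vertex are pebbled.  A winning strategy is
    turned into a reversible pebbling by Bennett's recursion.  Conversely, with
    [k] pebbles every reachable configuration can be ordered as
    [u_1, ..., u_m] so that the pebbler wins from [u_i] with [k - i + 1] pebbles
    when [u_1, ..., u_(i-1)] are given: placing a vertex appends it, and a vertex
    whose predecessors are pebbled can be deleted from the order.

    Strategies on the tree project to the pyramid, so an upper bound on the tree
    and a lower bound on the pyramid suffice.  On the tree the pebbler cuts off
    a spine of length [h - g (D - 1)], pebbles its lower end and finishes by
    binary search.  On the pyramid the challenger stays until the last open path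
    is closed by some [u]; then one of the triangle below [u] and the path above
    [u] is large.

    With [u_2 = 0] and [u_(i+1) = u_i + 2 ^ u_i + 1] one has
    [g D = 2 ^ u_2 + ... + 2 ^ u_D], so [ginv n] is found by comparing the bits of
    [n], least significant first, with a string whose next 1 is located by a
    counter of [u_i] bits. *)

Set Implicit Arguments.
Unset Strict Implicit.
Unset Printing Implicit Defensive.

(** * The Dymond-Tompa game and reversible pebbling *)

Section Game.

Variable G : dag.
Implicit Types (u v w x y : G) (B P Q : {set G}) (s : seq G).

(** The premises of [wins_query] are the two answers of the challenger; after a jump to [u], [u] is
    challenged and not given. The bound counts the last pebble, on the challenged vertex, hence
    [k.+1] in [wins_now]. *)
Inductive pebbler_wins : nat -> G -> {set G} -> Prop :=
| wins_now k v B : preds v \subset B -> pebbler_wins k.+1 v B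
| wins_query k u v B :
    pebbler_wins k u B -> pebbler_wins k v (u |: B) -> pebbler_wins k.+1 v B.

Lemma pebbler_wins_gt0 k v B : pebbler_wins k v B -> 0 < k.
Proof. by case. Qed.

Lemma pebbler_wins_sub k v B B' :
  B \subset B' -> pebbler_wins k v B -> pebbler_wins k v B'.
Proof.
move=> sBB' win; elim: win B' sBB' => {k v B} [k v B predB|k u v B _ IHu _ IHv] B' sBB'.
  exact/wins_now/(subset_trans predB).
by apply: wins_query (IHu _ sBB') _; apply: IHv; apply: setUS.
Qed.

Lemma pebbler_wins_leq k k' v B :
  k <= k' -> pebbler_wins k v B -> pebbler_wins k' v B.
Proof.
move=> lekk' win; elim: win k' lekk' => {k v B} [k v B predB|k u v B _ IHu _ IHv] [|k'] // lekk'.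
  exact: wins_now.
by apply: wins_query; [apply: IHu | apply: IHv].
Qed.

Definition ancestors v : {set G} :=
  [set u | [exists w, edge w v && connect (@edge G) u w]].

Lemma preds_ancestors v : preds v \subset ancestors v.
Proof.
by apply/subsetP=> u; rewrite !inE => uv; apply/existsP; exists u; rewrite uv connect0.
Qed.

Lemma ancestors_trans u v : u \in ancestors v -> ancestors u \subset ancestors v.
Proof.
rewrite inE => /existsP[w /andP[wv uw]]; apply/subsetP=> x.
rewrite !inE => /existsP[y /andP[yu xy]]; apply/existsP; exists w; rewrite wv /=.
exact: connect_trans (connect_trans xy (connect1 yu)) uw.
Qed.

Lemma ancestors_irrefl v : v \notin ancestors v.
Proof.
rewrite inE; apply/existsPn=> w; apply/negP=> /andP[wv /connectP[p vp lastp]].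
by have/(@dag_acyclic G) : cycle (@edge G) (v :: p) by rewrite /= rcons_path vp -lastp.
Qed.

(** A query outside the ancestors of the challenged vertex cannot help and is skipped. *)
Lemma pebbler_wins_ancestors k v B :
  pebbler_wins k v B -> pebbler_wins k v (B :&: ancestors v).
Proof.
elim=> {k v B} [k v B predB|k u v B _ IHu _ IHv].
  by apply: wins_now; rewrite subsetI predB preds_ancestors.
have [uv | uNv] := boolP (u \in ancestors v).
  apply: (wins_query (u := u)).
    by apply: pebbler_wins_sub IHu; apply/setIS/ancestors_trans.
  by apply: pebbler_wins_sub IHv; rewrite setIUl setSU // subsetIl.
apply: (pebbler_wins_leq (leqnSn k)); apply: pebbler_wins_sub IHv.
by apply/subsetP=> x; rewrite !inE => /andP[/orP[/eqP->|-> ->//]];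
  rewrite inE in uNv; rewrite (negbTE uNv).
Qed.

Definition bounded_move k : rel {set G} :=
  [rel P Q | [&& pebble_move P Q, #|P| <= k & #|Q| <= k]].

(** By acyclicity no vertex is its own predecessor, so a move keeps the pebbles that permit it. *)
Lemma pebble_move_sym P Q : pebble_move P Q = pebble_move Q P.
Proof.
suff sub P1 Q1 : pebble_move P1 Q1 -> pebble_move Q1 P1 by apply/idP/idP; apply: sub.
have vNpreds v : v \notin preds v.
  by apply: contra (ancestors_irrefl v); apply/subsetP/preds_ancestors.
case/existsP=> v /andP[sP /orP[] /andP[vP /eqP->]]; apply/existsP; exists v.
  by rewrite (subset_trans sP (subsetUr _ _)) setU11 setU1K // !eqxx orbT.
by rewrite subsetD1 sP vNpreds /= setD11 setD1K // eqxx.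
Qed.

Lemma bounded_connect_sym k : connect_sym (bounded_move k).
Proof.
apply: sym_connect_sym => P Q; rewrite /bounded_move /=.
by rewrite pebble_move_sym; congr (_ && _); apply: andbC.
Qed.

Lemma bounded_connect_leq k k' P Q : k <= k' ->
  connect (bounded_move k) P Q -> connect (bounded_move k') P Q.
Proof.
move=> lekk'; apply: connect_sub => P1 Q1 /= /and3P[mv leP leQ].
by apply: connect1; rewrite /bounded_move /= mv !(leq_trans _ lekk').
Qed.

Lemma bounded_connectU1 k v P Q : connect (bounded_move k) P Q ->
  connect (bounded_move k.+1) (v |: P) (v |: Q).
Proof.
case/connectP=> s + ->; elim: s P => [|P' s IHs] P /=; first by rewrite connect0.
case/andP=> /and3P[mv leP leP'] /IHs; apply: connect_trans.
have leU (R : {set G}) : #|R| <= k -> #|v |: R| <= k.+1.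
  by move=> leR; rewrite cardsU1 -add1n leq_add // leq_b1.
case/existsP: mv leP' => u /andP[sP alt] leP'.
(* With [v] pebbled throughout, a move on [v] becomes no move at all. *)
have [<-|neq_uv] := eqVneq u v.
  case/orP: alt => /andP[_ /eqP->]; first by rewrite setUA setUid connect0.
  by rewrite (setUC _ (P :\ u)) setUC setDE setUIl (setUC (~: _)) setUCr setIT connect0.
apply: connect1; rewrite /bounded_move /= !leU // !andbT; apply/existsP; exists u.
rewrite (subset_trans sP (subsetUr _ _)) !inE negb_or neq_uv /= (negbTE neq_uv) /=.
case/orP: alt => /andP[-> /eqP->]; first by rewrite setUCA eqxx.
suff -> : v |: P :\ u = (v |: P) :\ u by rewrite eqxx ?orbT.
by apply/setP=> x; rewrite !inE; case: (eqVneq x v) => [->|]; rewrite 1?eq_sym ?neq_uv.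
Qed.

(* Bennett's recursion: place [u], use it to place [v], and take [u] away by
   reversing its placement while [v] stays. *)
Lemma pebbler_wins_connect k v B : pebbler_wins k v B ->
  connect (bounded_move (#|B| + k)) B (v |: B).
Proof.
elim=> {k v B} [k v B predB|k u v B _ IHu _ IHv].
  have [vB|vNB] := boolP (v \in B); first by rewrite (setUidPr _) ?sub1set ?connect0.
  apply: connect1; rewrite /bounded_move /= cardsU1 vNB; apply/and3P; split; try lia.
  by apply/existsP; exists v; rewrite predB vNB eqxx.
have leU : #|u |: B| <= #|B|.+1 by rewrite cardsU1; case: (u \notin B).
apply: (connect_trans (bounded_connect_leq _ IHu)); first lia.
apply: (connect_trans (bounded_connect_leq _ IHv)); first lia.
by rewrite addnS bounded_connect_sym; apply: bounded_connectU1.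
Qed.

(** * Orders on reachable configurations *)

Fixpoint orderly k B s : Prop :=
  if s is u :: s' then pebbler_wins k u B /\ orderly k.-1 (u |: B) s' else True.

Lemma orderly_rcons k B s v : size s < k -> preds v \subset B :|: [set x in s] ->
  orderly k B s -> orderly k B (rcons s v).
Proof.
elim: s k B => [|u s IHs] [|k] B //= lt_sk predv.
  move=> _; split=> //; apply: wins_now; apply: subset_trans predv _.
  by apply/subsetP=> x; rewrite !inE orbF.
case=> win ord; split=> //; apply: IHs => //.
by apply: subset_trans predv _; apply/subsetP=> x; rewrite !inE; case: (x == u); rewrite ?orbT.
Qed.

(* Pebbling the vertices of [s] that do not depend on [v] makes all
   predecessors of [v] available. *)
Lemma orderly_wins k v B B' s : orderly k B' s ->
  preds v \subset B :|: [set x in s] ->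
  (forall x, v \notin ancestors x -> B' :&: ancestors x \subset B) ->
  pebbler_wins k.+1 v B.
Proof.
elim: s k B B' => [|x s IHs] k B B' /=.
  move=> _ predv _; apply: wins_now; apply: subset_trans predv _.
  by apply/subsetP=> y; rewrite !inE orbF.
case=> win ord predv B'B; have k_gt0 := pebbler_wins_gt0 win.
(* A vertex that is [v] or depends on [v] is no predecessor of [v]: it is skipped. Any other is
   queried. *)
have [down|/norP[vNx neq_xv]] := boolP ((v \in ancestors x) || (x == v)).
  apply: (@pebbler_wins_leq k.-1.+1); first by rewrite prednK.
  apply: IHs ord _ _.
    apply/subsetP=> y yv; have := subsetP predv y yv; rewrite !inE.
    case: eqVneq => [eq_yx|_ //]; case/negP: (ancestors_irrefl v).
    have yv' : y \in ancestors v := subsetP (preds_ancestors v) y yv.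
    case/orP: down => [vx|/eqP eq_xv]; last by rewrite -{1}eq_xv -eq_yx.
    by apply: (subsetP (ancestors_trans yv')); rewrite eq_yx.
  move=> y vNy; apply: subset_trans (B'B y vNy); apply/subsetP=> z.
  rewrite in_setI in_setU1 => /andP[/orP[/eqP->|zB' zy]] => [xy|]; last by rewrite in_setI zB'.
  case/negP: vNy; case/orP: down => [|/eqP<-//].
  exact/subsetP/ancestors_trans.
rewrite -(prednK k_gt0); apply: (wins_query (u := x)).
  by rewrite prednK //; apply: pebbler_wins_sub (pebbler_wins_ancestors win); apply: B'B.
apply: IHs ord _ _.
  by apply: subset_trans predv _; apply/subsetP=> y; rewrite !inE; case: (y == x); rewrite ?orbT.
by move=> y vNy; rewrite setIUl setUSS ?subsetIl ?B'B.
Qed.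

(** Each later vertex moves up one place and gains a pebble. If it depends on [v], this pays for a
    query of [v], won by [orderly_wins]; otherwise its strategy can do without [v]. *)
Lemma orderly_behead k v B s : orderly k.+1 B (v :: s) ->
  preds v \subset B :|: [set x in s] -> orderly k.+1 B s.
Proof.
case=> _ /=; elim: s k B => [|y s IHs] k B //= [win ord] predv.
have k_gt0 := pebbler_wins_gt0 win.
split; last first.
  rewrite -(prednK k_gt0); apply: IHs; last first.
    by apply: subset_trans predv _; apply/subsetP=> x; rewrite !inE; case: (x == y); rewrite ?orbT.
  by rewrite setUCA.
have [vy|vNy] := boolP (v \in ancestors y); last first.
  apply: (pebbler_wins_leq (leqnSn k)); apply: pebbler_wins_sub (pebbler_wins_ancestors win).
  apply/subsetP=> z; rewrite in_setI in_setU1 => /andP[/orP[/eqP->|//]].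
  by rewrite (negbTE vNy).
apply: wins_query win; rewrite -(prednK k_gt0); apply: orderly_wins ord _ _.
  apply/subsetP=> z zv; have := subsetP predv z zv; rewrite !inE.
  case: eqVneq => [eq_zy|_ //]; case/negP: (ancestors_irrefl v).
  have zv' := subsetP (preds_ancestors v) z zv.
  by apply: (subsetP (ancestors_trans zv')); rewrite eq_zy.
move=> x vNx; apply/subsetP=> z; rewrite in_setI !in_setU1.
case/andP=> /or3P[/eqP->|/eqP->|//]; last by rewrite (negbTE vNx).
by move=> yx; case/negP: vNx; apply: (subsetP (ancestors_trans yx)).
Qed.

Lemma orderly_del k B s1 v s2 : orderly k B (s1 ++ v :: s2) ->
  preds v \subset B :|: [set x in s1 ++ s2] -> orderly k B (s1 ++ s2).
Proof.
elim: s1 k B => [|u s1 IHs] k B.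
  case: k => [|k]; last exact: orderly_behead.
  by case=> /pebbler_wins_gt0.
case=> win ord predv; split=> //; apply: IHs ord _.
by apply: subset_trans predv _; apply/subsetP=> x; rewrite !inE; case: (x == u); rewrite ?orbT.
Qed.

Definition has_order k P : Prop :=
  exists s, [/\ uniq s, P = [set x in s] & orderly k set0 s].

Lemma has_order_move k P Q :
  bounded_move k P Q -> has_order k P -> has_order k Q.
Proof.
case/and3P=> /existsP[v /andP[predv alt]] leP leQ [s [uniqs Ps ord]].
case/orP: alt => /andP[vP /eqP Qv].
  have vs : v \notin s by move: vP; rewrite Ps inE.
  exists (rcons s v); split; first by rewrite rcons_uniq vs.
    by rewrite Qv Ps; apply/setP=> x; rewrite !inE mem_rcons inE.
  apply: orderly_rcons; last by [].
    by move: leQ; rewrite Qv cardsU1 vP Ps cardsE (card_uniqP uniqs).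
  by rewrite set0U -Ps.
have vs : v \in s by move: vP; rewrite Ps inE.
case/splitPr: vs uniqs Ps ord => s1 s2 uniqs Ps ord.
have /andP[vN uniqs12] : uniq (v :: s1 ++ s2).
  by rewrite -(perm_uniq (permEl (perm_catCA s1 [:: v] s2))).
have vNpreds : v \notin preds v.
  by apply: contra (ancestors_irrefl v); apply/subsetP/preds_ancestors.
have Qs : Q = [set x in s1 ++ s2].
  rewrite Qv Ps; apply/setP=> x; rewrite !inE !mem_cat inE.
  case: eqVneq => [->|] //=; move: vN; rewrite mem_cat => /negbTE->//.
exists (s1 ++ s2); split=> //; apply: orderly_del ord _.
by rewrite set0U -Qs Qv subsetD1 predv.
Qed.

Lemma has_order_connect k P : connect (bounded_move k) set0 P -> has_order k P.
Proof.
have: has_order k set0 by exists [::]; split=> //; apply/setP=> x; rewrite !inE.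
move=> ord0 /connectP[s + ->]; elim: s set0 ord0 => [|P' s IHs] P0 ord0 //=.
by case/andP=> mv; apply: IHs; apply: has_order_move ord0.
Qed.

(** * Price and value of the game *)

Lemma pebbling_space_leq P0 (s : seq {set G}) k :
  (pebbling_space P0 s <= k) = all (fun P => #|P| <= k) (P0 :: s).
Proof.
by rewrite /pebbling_space big_seq; apply/bigmax_leqP_seq/allP => [H P Ps|H P Ps _]; apply: H.
Qed.

Lemma path_bounded_move k P0 (s : seq {set G}) : pebbling_space P0 s <= k ->
  path (bounded_move k) P0 s = reversible_pebbling P0 s.
Proof.
rewrite pebbling_space_leq /reversible_pebbling; elim: s P0 => [|P s IHs] P0 //=.
case/and3P=> le0 leP les; rewrite IHs /= ?leP //.
by congr (_ && _); rewrite /bounded_move /= le0 leP !andbT.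
Qed.

Lemma bounded_path_space k P0 (s : seq {set G}) : #|P0| <= k ->
  path (bounded_move k) P0 s -> pebbling_space P0 s <= k.
Proof.
rewrite pebbling_space_leq; elim: s P0 => [|P s IHs] P0 /= le0; first by rewrite le0.
by case/andP=> /and3P[_ _ leP] /(IHs _ leP) /=; rewrite le0.
Qed.

(** An order on the final configuration has the sink as its single entry, and so is a winning
    strategy from the sink with nothing given. *)
Lemma persistent_price_game n : pebbler_wins n (sink G) set0 ->
  (forall k, pebbler_wins k (sink G) set0 -> n <= k) -> persistent_price_is G n.
Proof.
move=> win minwin.
have low (s : seq {set G}) : persistent_pebbling s -> n <= pebbling_space set0 s.
  case/andP=> peb lasts; apply: minwin.
  have: connect (bounded_move (pebbling_space set0 s)) set0 [set sink G].
    by apply/connectP; exists s; [rewrite path_bounded_move | rewrite (eqP lasts)].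
  case/has_order_connect=> -[|x [|y t]] [].
  - by move=> _ /setP/(_ (sink G)); rewrite !inE eqxx.
  - by move=> _ /setP/(_ (sink G)); rewrite !inE eqxx => /esym/eqP-> [].
  move=> uniqs /setP eqs; have:= eqs x; have := eqs y; rewrite !inE !eqxx ?orbT.
  by move=> /eqP ey /eqP ex; move: uniqs; rewrite ex ey /= inE eqxx.
split=> //; have := pebbler_wins_connect win; rewrite cards0 add0n setU0.
case/connectP=> s paths lasts.
have les : pebbling_space set0 s <= n by apply: bounded_path_space paths; rewrite cards0.
have pers : persistent_pebbling s.
  by rewrite /persistent_pebbling -(path_bounded_move les) paths -lasts eqxx.
by exists s => //; apply/eqP; rewrite eqn_leq les low.
Qed.

End Game.

(** The pebbler queries the images of the queries in [G]; by [fpreds], once the predecessors of [v]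
    are given, so are those of [f v]. *)
Lemma pebbler_wins_map (G H : dag) (f : G -> H) :
    (forall v, preds (f v) \subset f @: preds v) ->
  forall k v B, pebbler_wins k v B -> pebbler_wins k (f v) (f @: B).
Proof.
move=> fpreds k v B; elim=> {k v B} [k v B predB|k u v B _ IHu _ IHv].
  by apply: wins_now; apply: subset_trans (fpreds v) _; apply: imsetS.
by apply: wins_query IHu _; rewrite -imsetU1.
Qed.

Lemma g_recE D : g D.+2 = 2 ^ (g D.+1 + D) + g D.+1.
Proof. by have -> : g D.+1 + D = g D.+1 + D.+2 - 2 by lia. Qed.

(** * Upper bound on the tree *)

Section TreeUpper.

Variable h : nat.
Implicit Types (w : seq bool) (B : {set binary_tree h}).

Definition tree_at w : binary_tree h := insubd (tree_root h) w.

Lemma tree_atK w : size w <= h -> val (tree_at w) = w.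
Proof. by move=> le_wh; rewrite insubdK. Qed.

Lemma preds_tree_leaf w : size w = h -> preds (tree_at w) = set0.
Proof.
move=> eq_wh; apply/setP=> u; rewrite !inE; apply/existsPn=> b.
rewrite tree_atK ?eq_wh //; apply/eqP=> uE.
by have := size_bseq u; rewrite uE /= eq_wh ltnn.
Qed.

Lemma preds_tree_sub w B : size w < h ->
  tree_at (false :: w) \in B -> tree_at (true :: w) \in B ->
  preds (tree_at w) \subset B.
Proof.
move=> lt_wh Bf Bt; apply/subsetP=> u; rewrite inE => /existsP[b /eqP].
rewrite tree_atK 1?ltnW // => uE; have -> : u = tree_at (b :: w) by apply: val_inj; rewrite tree_atK.
by case: b {uE}.
Qed.

(* Binary search along the right spine below [w], all of whose side branches
   are pebbled. *)
Lemma spine_wins j i w B : 0 < i <= 2 ^ j -> size w + i <= h ->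
  (forall t, t < i -> tree_at (false :: nseq t true ++ w) \in B) ->
  tree_at (nseq i true ++ w) \in B ->
  pebbler_wins j.+1 (tree_at w) B.
Proof.
elim: j i w B => [|j IHj] i w B /andP[i_gt0 le_i] leh Bf Bt.
  have i1 : i = 1 by lia.
  rewrite i1 in leh Bf Bt; apply: wins_now; apply: preds_tree_sub => //; first lia.
  exact: (Bf 0).
have [le_ij|lt_ji] := leqP i (2 ^ j).
  by apply: (pebbler_wins_leq (leqnSn _)); apply: (IHj i); rewrite ?i_gt0.
rewrite expnS in le_i; have pos : 0 < 2 ^ j by rewrite expn_gt0.
have nseqD t : nseq t true ++ nseq (i - 2 ^ j) true ++ w = nseq (t + (i - 2 ^ j)) true ++ w.
  by rewrite catA -nseqD.
(* This leaves a spine of length [2 ^ j] below the query and one of length [i - 2 ^ j], at most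
   [2 ^ j], above it. *)
apply: (wins_query (u := tree_at (nseq (i - 2 ^ j) true ++ w))).
  apply: (IHj (2 ^ j)).
  - by rewrite pos leqnn.
  - by rewrite size_cat size_nseq; lia.
  - by move=> t lt_t; rewrite nseqD; apply: Bf; lia.
  by rewrite nseqD (_ : _ + _ = i) //; lia.
apply: (IHj (i - 2 ^ j)); try lia.
- by move=> t lt_t; rewrite in_setU Bf ?orbT //; lia.
by rewrite setU11.
Qed.

(* Side branches of the right spine are pebbled from the top: a challenge
   there has lost one level per pebble.  At height [g D.+1] the spine vertex
   itself is pebbled, which leaves a path short enough for binary search. *)
Lemma tree_wins D m w : m <= g D.+1 -> size w + m = h ->
  pebbler_wins (m + D.+1) (tree_at w) set0.
Proof.
elim: D m w => [|D IHD] m w.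
  rewrite leqn0 => /eqP-> szw; apply: wins_now; rewrite preds_tree_leaf ?sub0set //.
  by rewrite addn0 in szw.
elim/ltn_ind: m w => m IHm w le_m szw.
have [le_mD|lt_Dm] := leqP m (g D.+1).
  by rewrite addnS; apply: (pebbler_wins_leq (leqnSn _)); apply: IHD.
pose L := m - g D.+1.
have leL : 0 < L <= 2 ^ (g D.+1 + D) by move: le_m; rewrite g_recE /L; lia.
(* [r] counts the side branches along the first [L] levels of the spine that may still be
   unpebbled. *)
suff spine r B : r <= L ->
    (forall t, t < L - r -> tree_at (false :: nseq t true ++ w) \in B) ->
    pebbler_wins (g D.+1 + D.+2 + r) (tree_at w) B.
  have := spine L set0 (leqnn L); rewrite subnn => /(_ (fun _ => ltac:(by []))).
  by apply: pebbler_wins_leq; rewrite /L; lia.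
elim: r B => [|r IHr] B le_rL Bf.
  rewrite addn0 addnS; apply: (wins_query (u := tree_at (nseq L true ++ w))).
    apply: (pebbler_wins_sub (sub0set _)); apply: IHD => //.
    by rewrite size_cat size_nseq /L; lia.
  rewrite addnS; apply: (spine_wins leL) => [|t lt_t|]; rewrite ?setU11 //; first by rewrite /L; lia.
  by rewrite in_setU Bf ?orbT // subn0.
rewrite addnS; apply: (wins_query (u := tree_at (false :: nseq (L - r.+1) true ++ w))).
  apply: (pebbler_wins_sub (sub0set _)).
  have -> : g D.+1 + D.+2 + r = (m - (L - r)) + D.+2 by rewrite /L; lia.
  apply: IHm; [lia | lia |].
  by rewrite [size _]/= size_cat size_nseq; lia.
apply: IHr; first lia.
move=> t lt_t; rewrite in_setU1; have [->|ne_t] := eqVneq t (L - r.+1); first by rewrite eqxx.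
by rewrite Bf ?orbT //; lia.
Qed.

End TreeUpper.

(** * Lower bound on the pyramid *)

Section PyramidLower.

Variable h : nat.
Implicit Types (u v w b : pyramid h) (B : {set pyramid h}).

(** Constant along the edges that raise [j], as [pyr_j] is along the others. *)
Definition pyr_a v := pyr_j v - pyr_i v.

Lemma pyr_le v : pyr_i v <= pyr_j v <= h.
Proof. by rewrite (valP v) -ltnS ltn_ord. Qed.

Lemma pyramid_at i j : i <= j <= h -> exists v, pyr_i v = i /\ pyr_j v = j.
Proof.
case/andP=> le_ij le_jh; have lti : i < h.+1 by lia.
have ltj : j < h.+1 by lia.
by exists (exist _ (Ordinal lti, Ordinal ltj) le_ij).
Qed.

Lemma pyr_inj u v : pyr_i u = pyr_i v -> pyr_j u = pyr_j v -> u = v.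
Proof.
by move=> ei ej; apply/val_inj/eqP/andP; split; apply/eqP/val_inj.
Qed.

Lemma pyr_edgeP u v : edge u v = (pyr_i v == (pyr_i u).+1) &&
  ((pyr_j v == pyr_j u) || (pyr_j v == (pyr_j u).+1)).
Proof.
rewrite /edge /= /pyramid_edge; have := pyr_le u; have := pyr_le v.
move: (pyr_i u) (pyr_i v) (pyr_j u) (pyr_j v) => iu iv ju jv; lia.
Qed.

(** The triangle with apex [v]: the vertices with a path to [v]. *)
Definition below v : {set pyramid h} :=
  [set u | (pyr_a v <= pyr_a u) && (pyr_j u <= pyr_j v)].

Lemma below_edge u v : edge u v -> below u \subset below v.
Proof.
rewrite pyr_edgeP => euv; apply/subsetP=> w; rewrite !inE /pyr_a.
have := pyr_le u; have := pyr_le v; have := pyr_le w; lia.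
Qed.

Lemma below_refl v : v \in below v. Proof. by rewrite inE !leqnn. Qed.

(** Some path from a source to [v], both ends included, avoids [B]. *)
Inductive open B : pyramid h -> Prop :=
| open_source v : pyr_i v = 0 -> v \notin B -> open B v
| open_edge w v : open B w -> edge w v -> v \notin B -> open B v.

Lemma open_notin B v : open B v -> v \notin B.
Proof. by case. Qed.

Lemma left_open B a n v : (forall b, pyr_a b = a -> pyr_i b < n -> b \notin B) ->
  pyr_a v = a -> pyr_i v <= n -> v \notin B -> open B v.
Proof.
move=> free; move: {2}(pyr_i v) (erefl (pyr_i v)) => i; elim: i v => [|i IHi] v iv av le_v vB.
  exact: open_source.
have lev := pyr_le v; have := @pyramid_at i (pyr_j v).-1 ltac:(lia).
case=> w [iw jw]; have aw : pyr_a w = a by move: av; rewrite /pyr_a iw jw; lia.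
by apply: (@open_edge B w) => //; [apply: IHi => //; rewrite ?free //; lia|rewrite pyr_edgeP; lia].
Qed.

Lemma right_open B j n v : (forall b, pyr_j b = j -> pyr_i b < n -> b \notin B) ->
  pyr_j v = j -> pyr_i v <= n -> v \notin B -> open B v.
Proof.
move=> free; move: {2}(pyr_i v) (erefl (pyr_i v)) => i; elim: i v => [|i IHi] v iv jv le_v vB.
  exact: open_source.
have lev := pyr_le v; have := @pyramid_at i (pyr_j v) ltac:(lia).
case=> w [iw jw].
by apply: (@open_edge B w) => //; [apply: IHi => //; rewrite ?free //; lia|rewrite pyr_edgeP; lia].
Qed.

Lemma card_below_edge B w v b : edge w v -> b \in B -> b \in below v ->
  b \notin below w -> #|B :&: below w| < #|B :&: below v|.
Proof.
move=> wv bB bv bw; apply/proper_card/properP; split; first exact/setIS/below_edge.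
by exists b; rewrite in_setI bB // (negbTE bw).
Qed.

(* When pebbling [u] closes every path to [v], each step of the path from [u]
   to [v] turns away from an edge of the triangle that [B] must block. *)
Lemma open_setU1 B u v : open B v -> open (u |: B) v \/
  open B u /\ exists q : seq (pyramid h),
    [/\ path (@edge (pyramid h)) u q, last u q = v, all (fun x => x \notin B) q,
        pyr_i u + size q = pyr_i v &
        (u \in below v) && (#|B :&: below u| + size q <= #|B :&: below v|)].
Proof.
elim=> {v} [v iv vB|w v opw IHw wv vB].
  have [<-|neq_vu] := eqVneq v u.
    right; split; first exact: open_source.
    by exists [::]; rewrite /= !addn0 below_refl leqnn.
  by left; apply: open_source; rewrite // in_setU1 negb_or neq_vu.
have [<-|neq_vu] := eqVneq v u.
  right; split; first exact: open_edge wv vB.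
  by exists [::]; rewrite /= !addn0 below_refl leqnn.
have vuB : v \notin u |: B by rewrite in_setU1 negb_or neq_vu.
case: IHw => [opuw|[opu [q [pathq lastq freeq iq /andP[uw le_q]]]]].
  by left; apply: open_edge opuw wv vuB.
have uv : u \in below v := subsetP (below_edge wv) u uw.
have lev := pyr_le v; have lew := pyr_le w.
have := wv; rewrite pyr_edgeP => /andP[/eqP iv jv].
(* One side of the triangle of [v] lies outside [below w]. If it is free, it is an open path to [v];
   otherwise a pebble on it, which is not [u], counts for [v] but not for [w]. *)
suff: (exists b, [/\ b \in u |: B, b \in below v & b \notin below w]) \/
    open (u |: B) v.
  case=> [[b [bB bv bw]]|]; last by left.
  right; split=> //; exists (rcons q v).
  have {}bB : b \in B.
    by case/setU1P: bB => // eb; case/negP: bw; rewrite eb.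
  rewrite rcons_path pathq lastq wv last_rcons all_rcons vB freeq uv size_rcons.
  split=> //; first by rewrite addnS iq iv.
  by rewrite addnS; apply: leq_ltn_trans le_q (card_below_edge wv bB bv bw).
case/orP: jv => /eqP jv.
  have [/existsP[b /and3P[bB ab ib]]|/existsPn none] :=
      boolP [exists b, [&& b \in u |: B, pyr_a b == pyr_a v & pyr_i b < pyr_i v]].
    left; exists b; rewrite bB !inE; have leb := pyr_le b.
    by move: ab ib lev leb lew iv jv; rewrite /pyr_a; clear; split=> //; lia.
  right; apply: (left_open (a := pyr_a v) (n := pyr_i v)) => // b ab ib.
  by have := none b; rewrite ab ib eqxx !andbT.
have [/existsP[b /and3P[bB ab ib]]|/existsPn none] :=
    boolP [exists b, [&& b \in u |: B, pyr_j b == pyr_j v & pyr_i b < pyr_i v]].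
  left; exists b; rewrite bB !inE; have leb := pyr_le b.
  by move: ab ib lev leb lew iv jv; rewrite /pyr_a; clear; split=> //; lia.
right; apply: (right_open (j := pyr_j v) (n := pyr_i v)) => // b ab ib.
by have := none b; rewrite ab ib eqxx !andbT.
Qed.

End PyramidLower.

(** A query on a free path cuts it in two, and the challenger can keep the longer part: he jumps for
    the part up to [u] and stays for the rest. *)
Lemma path_wins_leq (G : dag) k (v : G) B : pebbler_wins k v B ->
  forall x p, path (@edge G) x p -> last x p = v -> all (fun y => y \notin B) (x :: p) ->
  uniq (x :: p) -> (size p).+1 <= 2 ^ k.-1.
Proof.
elim=> {k v B} [k v B predB|k u v B winu IHu winv IHv] x p.
  case/lastP: p => [|p y] pathp lastp free uniqp; first by rewrite expn_gt0.
  move: pathp; rewrite rcons_path last_rcons in lastp * => /andP[_]; rewrite lastp => lv.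
  have : last x p \in B by apply: (subsetP predB); rewrite inE.
  have : last x p \in x :: rcons p y by rewrite -rcons_cons mem_rcons inE mem_last orbT.
  by move/(allP free)/negP.
move=> pathp lastp free uniqp; have k_gt0 := pebbler_wins_gt0 winu.
have powE : 2 ^ k = 2 ^ k.-1 + 2 ^ k.-1 by rewrite -{1}(prednK k_gt0) expnS mul2n addnn.
rewrite [k.+1.-1]/= powE.
have [up|uNp] := boolP (u \in x :: p); last first.
  apply: leq_trans (leq_addr _ _); apply: IHv pathp lastp _ uniqp.
  apply/allP=> y yp; rewrite in_setU1 negb_or (allP free) // andbT.
  by apply: contraNneq uNp => <-.
case/splitPl: up pathp lastp free uniqp => p1 p2 lastp1.
rewrite cat_path lastp1 last_cat lastp1 => /andP[path1 path2] lastp2 free uniqp.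
move: uniqp; rewrite -cat_cons cat_uniq => /and3P[uniq1 dis uniq2].
have {free} /andP[free1 free2] : all (fun y => y \notin B) (x :: p1) && all (fun y => y \notin B) p2.
  by rewrite -all_cat cat_cons.
have le1 := IHu _ _ path1 lastp1 free1 uniq1.
case: p2 path2 lastp2 dis uniq2 free2 => [|y p2] path2 lastp2 dis uniq2 free2.
  by rewrite cats0; apply: leq_trans le1 (leq_addr _ _).
have le2 : (size p2).+1 <= 2 ^ k.-1.
  case/andP: path2 => _ path2; apply: (IHv y) => //.
  apply/allP=> z zp; rewrite in_setU1 negb_or (allP free2) // andbT.
  apply: contraNneq dis => zu; apply/hasP; exists z => //.
  by rewrite zu -lastp1 mem_last.
by rewrite size_cat /= -addSn leq_add.
Qed.

Lemma pyramid_edge_path_uniq h (u : pyramid h) q :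
  path (@edge (pyramid h)) u q -> uniq (u :: q).
Proof.
move=> pathq; apply: (@sorted_uniq _ (relpre (@pyr_i h) ltn)).
- by move=> y x z /=; apply: ltn_trans.
- by move=> x /=; rewrite ltnn.
apply: sub_path pathq => x y; rewrite pyr_edgeP => /andP[/eqP ixy _].
by rewrite /relpre /= ixy.
Qed.

(* The challenger stays as long as some path is open.  When [u] closes the last
   one, he jumps to [u] if the triangle below it is high enough; otherwise the
   path from [u] to [v] is long, and he stays. *)
Lemma pyramid_wins_geq h k (v : pyramid h) B : pebbler_wins k v B ->
  forall D, open B v -> D = 0 \/ g D < pyr_i v ->
  pyr_i v + D.+1 <= k + #|B :&: below v|.
Proof.
elim=> {k v B} [k v B predB|k u v B winu IHu winv IHv] D opv condD.
  case: opv predB condD => {v} [v iv _|w v opw wv _] predB.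
    by rewrite iv => -[->|]; lia.
  by case/negP: (open_notin opw); apply: (subsetP predB); rewrite inE.
case: (open_setU1 u opv) => [opuv|[opu [q [pathq lastq freeq iq /andP[_ le_q]]]]].
  have := IHv D opuv condD; rewrite setIUl.
  have : #|[set u] :&: below v| <= 1 by rewrite -(cards1 u) subset_leq_card ?subsetIl.
  by have := leq_of_leqif (leq_card_setU ([set u] :&: below v) (B :&: below v)); lia.
(* On a jump to [u] the height drops by [size q], which [le_q] makes up for, and the round spent
   lets [D] drop by one. *)
case: D condD => [|D] condD; first by have := IHu 0 opu (or_introl erefl); lia.
have {condD} lt_gv : g D.+1 < pyr_i v by case: condD.
case: D lt_gv => [|D] lt_gv; first by have := IHu 0 opu (or_introl erefl); lia.
have [le_ug|lt_gu] := leqP (pyr_i u) (g D.+1); last first.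
  by have := IHu D.+1 opu (or_intror lt_gu); lia.
rewrite g_recE in lt_gv.
have long : 2 ^ (g D.+1 + D) < size q by lia.
have uniqq := pyramid_edge_path_uniq pathq.
(* Now [u] is too low for a jump. As [le_q] credits [size q] pebbles and [pyr_i u] is at most
   [g D.+1], it suffices that the long path forces [k] to be large. *)
suff : g D.+1 + D < k.-1 by lia.
rewrite -(ltn_exp2l _ _ (ltnSn 1)); apply: leq_trans long _.
case: q pathq lastq freeq uniqq {iq le_q} => [|x q] // /andP[_ pathq] lastq freeq /andP[uNq uniqq].
apply: (path_wins_leq winv pathq lastq) => //.
apply/allP=> y yq; rewrite in_setU1 negb_or (allP freeq) // andbT.
by apply: contraNneq uNq => <-.
Qed.

Lemma open_set0 h (v : pyramid h) : open set0 v.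
Proof.
by apply: (left_open (a := pyr_a v) (n := pyr_i v)) => // *; rewrite in_set0.
Qed.

Lemma ginvP h : [/\ 0 < ginv h, h <= g (ginv h) &
  forall D, 0 < D -> h <= g D -> ginv h <= D].
Proof.
rewrite /ginv; case: ex_minnP => D /andP[D_gt0 le_hD] minD; split=> // D' D'_gt0 le_hD'.
by apply: minD; rewrite D'_gt0.
Qed.

(** At [(ginv h).-1], unless this is 0, [g] is still below [h] by minimality. *)
Lemma pyramid_price_geq h k :
  pebbler_wins k (sink (pyramid h)) set0 -> h + ginv h <= k.
Proof.
have [ginv_gt0 _ minD] := ginvP h.
move/pyramid_wins_geq=> /(_ (ginv h).-1 (open_set0 _)).
rewrite set0I cards0 addn0 prednK //; apply; rewrite -[pyr_i _]/h.
case: (posnP (ginv h).-1) => [->|pos]; first by left.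
by right; rewrite ltnNge; apply/negP=> /(minD _ pos); lia.
Qed.

(** * From the tree to the pyramid *)

Section Projection.

Variable h : nat.

Lemma tree_pyramid_subproof (v : binary_tree h) :
  h - size v <= h - count negb v <= h.
Proof. by rewrite leq_subr leq_sub2l ?count_size. Qed.

Lemma tree_pyramid_exists (v : binary_tree h) : exists x : pyramid h,
  (pyr_i x == h - size v) && (pyr_j x == h - count negb v).
Proof.
by have [x [ix jx]] := pyramid_at (tree_pyramid_subproof v); exists x; rewrite ix jx !eqxx.
Qed.

(** A word is read as a path down from the sink, [false] lowering [j] and [true] keeping it; the
    tree thus unfolds the pyramid. *)
Definition tree_pyramid (v : binary_tree h) : pyramid h :=
  xchoose (tree_pyramid_exists v).

Lemma tree_pyramidE v : pyr_i (tree_pyramid v) = h - size v /\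
  pyr_j (tree_pyramid v) = h - count negb v.
Proof. by have /andP[/eqP-> /eqP->] := xchooseP (tree_pyramid_exists v). Qed.

Lemma tree_pyramid_preds v :
  preds (tree_pyramid v) \subset tree_pyramid @: preds v.
Proof.
apply/subsetP=> x; rewrite inE pyr_edgeP.
have [-> ->] := tree_pyramidE v => /andP[/eqP ix jx].
have lev := size_bseq v; have lt_vh : size v < h by lia.
have cv := count_size negb v.
pose b := pyr_j x == h - count negb v.
have lt_bvh : size (b :: v) <= h by [].
apply/imsetP; exists (Bseq lt_bvh); first by rewrite inE; apply/existsP; exists b.
have [iE jE] := tree_pyramidE (Bseq lt_bvh); move: ix jx lev cv => /= ix jx lev cv.
apply: pyr_inj; rewrite ?iE ?jE /=; first lia.
by case/orP: jx => /eqP jx; rewrite /b jx ?eqxx ?ltn_eqF //=; lia.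
Qed.

Lemma tree_pyramid_root : tree_pyramid (tree_root h) = pyramid_sink h.
Proof. by have [iE jE] := tree_pyramidE (tree_root h); apply: pyr_inj; rewrite ?iE ?jE /= subn0. Qed.

End Projection.

Lemma tree_price_leq h :
  pebbler_wins (h + ginv h) (sink (binary_tree h)) set0.
Proof.
have [ginv_gt0 le_hg _] := ginvP h; rewrite -(prednK ginv_gt0).
have -> : sink (binary_tree h) = tree_at h [::] by apply: val_inj; rewrite /= insubdK.
by apply: tree_wins; rewrite ?prednK.
Qed.

Lemma pebbling_prices h : persistent_price_is (pyramid h) (h + ginv h) /\
  persistent_price_is (binary_tree h) (h + ginv h).
Proof.
have transfer k : pebbler_wins k (sink (binary_tree h)) set0 ->
    pebbler_wins k (sink (pyramid h)) set0.
  move/(pebbler_wins_map (@tree_pyramid_preds h)).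
  by rewrite imset0 tree_pyramid_root.
split; apply: persistent_price_game => [|k].
- exact/transfer/tree_price_leq.
- exact: pyramid_price_geq.
- exact: tree_price_leq.
by move/transfer/pyramid_price_geq.
Qed.

(** * Comparing binary digits with g *)

Fixpoint bits_val (s : seq bool) : nat :=
  if s is b :: s' then b + 2 * bits_val s' else 0.

Fixpoint add_bit (c : bool) (s : seq bool) : seq bool :=
  if s is b :: s' then (c (+) b) :: add_bit (c && b) s' else nseq c true.

Lemma add_bit0 s : add_bit false s = s.
Proof. by elim: s => //= b s ->. Qed.

Lemma bits_val_add_bit c s : bits_val (add_bit c s) = bits_val s + c.
Proof. by elim: s c => [|b s IHs] c /=; [case: c | rewrite IHs; case: b c => -[] /=; lia]. Qed.

Lemma size_add_bit c s : size (add_bit c s) <= (size s).+1.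
Proof. by elim: s c => [|b s IHs] c /=; [case: c | apply: IHs]. Qed.

Lemma bits_val_lt s : bits_val s < 2 ^ size s.
Proof. by elim: s => //= -[] s IHs; rewrite expnS; lia. Qed.

(** [last true s] says that [s] has no leading zero; the default [true] admits the empty word. *)
Lemma last_add_bit1 s : last true s -> last true (add_bit true s).
Proof.
have last_nil t b : t != [::] :> seq bool -> last b t = last true t by case: t.
have add_neq0 t : add_bit true t != [::] by case: t.
elim: s => [|[] s IHs] //=; last by rewrite add_bit0; case: s {IHs}.
by move=> lasts; rewrite last_nil // IHs.
Qed.

Lemma bits_val_ge s : last true s -> 2 ^ size s <= 2 * bits_val s + (s == [::]).
Proof.
elim: s => [|b s IHs] //= lasts; rewrite expnS addn0.
case: s b lasts IHs => [|b' s] b; first by case: b.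
by move=> lasts /(_ lasts); rewrite addn0; set n := bits_val _; lia.
Qed.

Lemma odd_bits_val s i : odd (bits_val s %/ 2 ^ i) = nth false s i.
Proof.
elim: s i => [|b s IHs] i /=; first by rewrite div0n nth_nil.
case: i => [|i]; first by rewrite divn1 oddD mul2n odd_double addbF; case: b.
have half : (b + 2 * bits_val s) %/ 2 = bits_val s by case: b; lia.
by rewrite expnS divnMA half IHs.
Qed.

Lemma binary_bits_val s : last true s -> binary (bits_val s) = s.
Proof.
move=> lasts; have szE : up_log 2 (bits_val s).+1 = size s.
  have [->//|s_neq0] := eqVneq s [::].
  have := bits_val_ge lasts; rewrite (negbTE s_neq0) addn0 => ge_s.
  have sz_gt0 : 0 < size s by case: s s_neq0 {ge_s lasts}.
  rewrite -(prednK sz_gt0); apply: up_log_eq; rewrite // prednK // bits_val_lt andbT ltnS.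
  by rewrite -(leq_pmul2l (isT : 0 < 2)) -expnS prednK.
apply: (@eq_from_nth _ false); rewrite size_mkseq szE // => i lti.
by rewrite nth_mkseq ?szE ?odd_bits_val.
Qed.

Lemma binaryP n : bits_val (binary n) = n /\ last true (binary n).
Proof.
have [s sn lasts] : exists2 s, bits_val s = n & last true s.
  elim: n => [|n [s sn lasts]]; first by exists [::].
  by exists (add_bit true s); rewrite ?bits_val_add_bit ?sn ?addn1 ?last_add_bit1.
by rewrite -sn binary_bits_val.
Qed.

Lemma binary_add_bit (c : bool) n : binary (n + c) = add_bit c (binary n).
Proof.
have [vn ln] := binaryP n.
rewrite -[in LHS]vn -bits_val_add_bit binary_bits_val //.
by case: c; [apply: last_add_bit1 | rewrite add_bit0].
Qed.

Lemma size_binary_leq n : size (binary n) <= n.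
Proof.
elim: n => // n IHn; rewrite -addn1 (binary_add_bit true).
by apply: leq_trans (size_add_bit _ _) _; rewrite addn1 ltnS.
Qed.

(** The exponents [u_D] of the binary ones of [g]. Truncated subtraction gives [mark_pos 1 = 0],
    which fits the initially empty counter. *)
Definition mark_pos D := g D.-1 + D - 2.

Lemma mark_posS D : mark_pos D.+3 = 2 ^ mark_pos D.+2 + mark_pos D.+2 + 1.
Proof.
rewrite /mark_pos [D.+3.-1]/= [D.+2.-1]/= g_recE.
have -> : g D.+1 + D.+2 - 2 = g D.+1 + D by lia.
lia.
Qed.

Lemma g_mark D : g D.+2 = 2 ^ mark_pos D.+2 + g D.+1.
Proof. by rewrite g_recE /mark_pos [D.+2.-1]/=; congr (2 ^ _ + _); lia. Qed.

Lemma g_lt_mark D : g D.+1 < 2 ^ mark_pos D.+2.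
Proof.
apply: (leq_trans (ltn_expl (g D.+1) (ltnSn 1))).
by rewrite leq_exp2l // /mark_pos [D.+2.-1]/=; lia.
Qed.

Lemma leq_g D D' : 0 < D -> D <= D' -> g D <= g D'.
Proof.
case: D => // D _; elim: D' => // D' IHD; rewrite leq_eqVlt => /orP[/eqP<-//|].
rewrite ltnS; case: D' IHD => // D' IHD /IHD le_g.
by rewrite g_recE; apply: leq_trans le_g (leq_addl _ _).
Qed.

(* After reading [p] bits of value [v], of which the [D.-1] positions
   [mark_pos 2], ..., [mark_pos D] carry a 1 of [g D]: [d] is the counter that
   will overflow at position [mark_pos D.+1], [s] tells it to pause, [f] is the
   comparison of [v] with [g D]. *)
Definition scan_inv p D (d : seq bool) k (s f : bool) v : Prop :=
  [/\ 0 < D <= p.+1,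
      if D == 1 then p = 0 else mark_pos D < p <= mark_pos D.+1,
      size d = mark_pos D /\ k = p - mark_pos D,
      s = (p == (mark_pos D).+1) /\ bits_val d = p - (mark_pos D).+2 &
      v < 2 ^ p /\ f = (v <= g D)].

(** The counter has fixed width: unlike in [add_bit], the last carry is dropped. *)
Fixpoint add_carry (c : bool) (s : seq bool) : seq bool :=
  if s is b :: s' then (c (+) b) :: add_carry (c && b) s' else [::].

Lemma size_add_carry c s : size (add_carry c s) = size s.
Proof. by elim: s c => //= b s IHs c; rewrite IHs. Qed.

Lemma bits_val_add_carry c s :
  bits_val (add_carry c s) + (c && all id s) * 2 ^ size s = bits_val s + c.
Proof.
elim: s c => [|b s IHs] c /=; first by rewrite andbT muln1.
have := IHs (c && b); rewrite expnS; case: b c => -[] /=; set x := 2 ^ _; set y := bits_val s;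
  set z := bits_val _; case: (all id s) => /=; lia.
Qed.

Lemma bits_val_all s : all id s = ((bits_val s).+1 == 2 ^ size s).
Proof.
have := bits_val_add_carry true s; have := bits_val_lt (add_carry true s).
rewrite size_add_carry /=; case: (all id s) => /=; have := bits_val_lt s; lia.
Qed.

Lemma bits_val_cat_zero s n : bits_val (s ++ nseq n false) = bits_val s.
Proof. by elim: s => [|b s /= ->//]; elim: n => //= n ->. Qed.

(** [c] is the digit of [g] at [p]: one pause and [2 ^ u] increments of a counter of [u] bits make
    up the gap in [mark_posS]. At an overflow the fillers widen the counter to [p] bits. The latest
    digit that differs decides the comparison. *)
Lemma scan_inv_step p D d k s f v b : scan_inv p D d k s f v ->
  let c := ~~ s && all id d in
  scan_inv p.+1 (D + c)
    (if c then add_carry (~~ s) d ++ nseq k false else add_carry (~~ s) d)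
    (if c then 1 else k.+1) c (if b == c then f else c) (v + b * 2 ^ p).
Proof.
case=> leD rng [szd kE] [sE vd] [lev fE] c.
have pos q : 0 < 2 ^ q by rewrite expn_gt0.
case: D leD rng szd kE sE vd fE => // D leD rng szd kE sE vd fE.
have cE : c = (p == mark_pos D.+2).
  rewrite /c bits_val_all szd vd sE; case: D {leD szd kE sE vd fE} rng => [->//|D] rng.
  by move: rng; rewrite /= mark_posS; have := pos (mark_pos D.+2); lia.
have lt_vb : v + b * 2 ^ p < 2 ^ p.+1 by rewrite expnS; case: b; lia.
have addE := bits_val_add_carry (~~ s) d.
case: (boolP c) => [c1|c0].
  have pE : p = mark_pos D.+2 by apply/eqP; rewrite -cE.
  have kp : mark_pos D.+1 <= p by case: D {leD szd kE sE vd fE cE pE} rng => [->|D /andP[/ltnW]].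
  rewrite addn1; split.
  - by rewrite leD.
  - by rewrite /= pE leqnn mark_posS /=; have := pos (mark_pos D.+2); lia.
  - by rewrite size_cat size_add_carry szd size_nseq kE -pE; lia.
  - split; first by rewrite -pE eqxx.
    rewrite -pE subSS subnS subnn /= bits_val_cat_zero.
    move: c1; rewrite /c => c1; move: addE; rewrite c1 mul1n.
    by move/andP: c1 => [-> /=]; rewrite bits_val_all => /eqP; lia.
  split=> //; have := g_lt_mark D; rewrite g_mark -pE fE.
  by case: b {lt_vb} => /=; lia.
rewrite addn0; have pneq : p != mark_pos D.+2 by rewrite -cE.
have Dgt : 0 < D.
  by case: D leD rng {szd kE sE vd fE cE} pneq => // _ ->.
case: D Dgt leD rng szd kE sE vd fE cE pneq => // D _ leD rng szd kE sE vd fE cE pneq.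
move: rng; rewrite [_ == 1]/= => /andP[lt_p le_p].
split.
- by lia.
- by rewrite /= ltnW //= ltn_neqAle pneq.
- by rewrite size_add_carry szd kE; lia.
- split; first by lia.
  move: addE; rewrite -/c (negbTE c0) mul0n addn0 vd sE; case: eqP => /=; lia.
split=> //; have := g_lt_mark D; rewrite fE (g_mark D).
have : 2 ^ (mark_pos D.+2).+1 <= 2 ^ p by rewrite leq_exp2l.
by rewrite expnS; case: b {lt_vb} => /=; lia.
Qed.

(** The bit length of [n] alone leaves only [D] and [D.+1], as each new power of 2 in [g] exceeds
    all that precedes it; [f] decides. *)
Lemma ginv_scan n D d k s f : scan_inv (size (binary n)) D d k s f n ->
  ginv n = D + ~~ f.
Proof.
case=> leD rng _ _ [ltn fE]; case: D leD rng fE => // D leD rng fE.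
have [vn ln] := binaryP n.
have [ginv_gt0 le_ng minD] := ginvP n.
have lowE D' : 0 < D' -> g D' < n -> D' < ginv n.
  move=> D'_gt0 lt_gn; rewrite ltnNge; apply/negP=> le_D.
  by have := leq_g ginv_gt0 le_D; lia.
apply/eqP; rewrite eqn_leq fE; case: (leqP n (g D.+1)) => [le_nD|lt_Dn]; last first.
  rewrite /= addn1 lowE // andbT; apply: minD => //; rewrite g_mark.
  apply: ltnW; apply: leq_trans ltn _; apply: leq_trans (leq_addr _ _).
  rewrite leq_exp2l //; case: D rng {lt_Dn fE leD} => [->//|D].
  by case/andP.
rewrite /= addn0 minD //=; case: D leD rng fE le_nD => // D leD /andP[lt_p _] fE le_nD.
apply: lowE => //; have := bits_val_ge ln; rewrite vn.
have -> : binary n == [::] = false by case: (binary n) lt_p.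
have : 2 ^ (mark_pos D.+2).+1 <= 2 ^ size (binary n) by rewrite leq_exp2l.
by have := g_lt_mark D; rewrite expnS; lia.
Qed.

(** * The Turing machine *)

(** For each input bit the machine sweeps over the counter and back; at an overflow it also
    increments [D] and rewinds. [Final] adds the outcome of the comparison to [D], and [Output]
    copies the result. *)
Variant ginv_state : Type :=
  | Start
  | Read of bool & bool
  | Sweep of bool & bool
  | Back of bool & bool
  | Incr of bool & bool
  | Rewind of bool & bool
  | Final of bool
  | Output
  | Halt.

Definition state_code (q : ginv_state) : 'I_9 * (bool * bool) :=
  match q with
  | Start => (@Ordinal 9 0 isT, (false, false))
  | Read f s => (@Ordinal 9 1 isT, (f, s))
  | Sweep f c => (@Ordinal 9 2 isT, (f, c))
  | Back f m => (@Ordinal 9 3 isT, (f, m))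
  | Incr f s => (@Ordinal 9 4 isT, (f, s))
  | Rewind f s => (@Ordinal 9 5 isT, (f, s))
  | Final c => (@Ordinal 9 6 isT, (c, false))
  | Output => (@Ordinal 9 7 isT, (false, false))
  | Halt => (@Ordinal 9 8 isT, (false, false))
  end.

Definition state_decode (x : 'I_9 * (bool * bool)) : ginv_state :=
  let: (i, (b, c)) := x in
  match val i with
  | 0 => Start
  | 1 => Read b c
  | 2 => Sweep b c
  | 3 => Back b c
  | 4 => Incr b c
  | 5 => Rewind b c
  | 6 => Final b
  | 7 => Output
  | _ => Halt
  end.

Lemma state_codeK : cancel state_code state_decode.
Proof. by case. Qed.

HB.instance Definition _ := Finite.copy ginv_state (can_type state_codeK).

Local Notation sym := (symbol unit).
Definition bit (b : bool) : sym := Some (inl b).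
Definition filler : sym := Some (inr tt).

(* Tape 0 holds the input, tape 1 the counter followed by fillers, one cell for
   each bit read so far, tape 2 the value of [D] in binary.  The first
   parameter of [Read], ..., [Rewind] is the comparison flag; the second one is
   the pause flag of the counter in [Read], [Incr], [Rewind] and its carry in
   [Sweep], [Back]. *)
Definition ginv_delta (q : ginv_state) (x0 x1 x2 : sym) :
    ginv_state * (sym * direction) * (sym * direction) * (sym * direction) :=
  match q with
  | Start => (Incr true false, (x0, Stay), (x1, Right), (x2, Right))
  | Read f s =>
      if x0 is Some (inl _) then (Sweep f (~~ s), (x0, Stay), (x1, Stay), (x2, Stay))
      else (Final (~~ f), (x0, Stay), (x1, Stay), (x2, Stay))
  | Sweep f c =>
      match x1 with
      | Some (inl b) => (Sweep f (c && b), (x0, Stay), (bit (c (+) b), Right), (x2, Stay))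
      | Some (inr _) => (Sweep f c, (x0, Stay), (x1, Right), (x2, Stay))
      | None => (Back f c, (x0, Stay), (filler, Left), (x2, Stay))
      end
  | Back f m =>
      match x1 with
      | Some (inl b) => (Back f m, (x0, Stay), (x1, Left), (x2, Stay))
      | Some (inr _) =>
          (Back f m, (x0, Stay), (if m then bit false else x1, Left), (x2, Stay))
      | None =>
          let f' := if x0 is Some (inl b) then if b == m then f else m else f in
          (if m then Incr f' true else Read f' false,
           (None, Right), (None, Right), (x2, Stay))
      end
  | Incr f s =>
      if x2 is Some (inl true)
      then (Incr f s, (x0, Stay), (x1, Stay), (bit false, Right))
      else (Rewind f s, (x0, Stay), (x1, Stay), (bit true, Left))
  | Rewind f s =>
      if x2 is None then (Read f s, (x0, Stay), (x1, Stay), (None, Right))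
      else (Rewind f s, (x0, Stay), (x1, Stay), (x2, Left))
  | Final c =>
      if x2 is Some (inl b)
      then (Final (c && b), (x0, Stay), (x1, Stay), (bit (c (+) b), Right))
      else if c then (Output, (x0, Stay), (x1, Stay), (bit true, Stay))
      else (Output, (x0, Stay), (x1, Stay), (None, Left))
  | Output =>
      if x2 is None then (Halt, (x0, Right), (x1, Stay), (x2, Stay))
      else (Output, (x2, Left), (x1, Stay), (x2, Left))
  | Halt => (Halt, (x0, Stay), (x1, Stay), (x2, Stay))
  end.

(** * Runs of the machine and their length *)

Definition tape_no (k : nat) : 'I_3 := inord k.

Definition ginv_machine : turing_machine :=
  @TuringMachine 2 unit ginv_state Start (pred1 Halt)
    (fun q x =>
       let: (q', a0, a1, a2) :=
         ginv_delta q (x (tape_no 0)) (x (tape_no 1)) (x (tape_no 2)) in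
       (q', [ffun i : 'I_3 => nth a0 [:: a0; a1; a2] i])).

Local Notation gtape := (tape unit).

Definition cfg (q : ginv_state) (t0 t1 t2 : gtape) : config ginv_machine :=
  (q, [ffun i : 'I_3 => nth t0 [:: t0; t1; t2] i]).

Definition tape_act (a : sym * direction) (t : gtape) : gtape :=
  tape_move a.2 (tape_write a.1 t).

Lemma step_cfg q t0 t1 t2 : q != Halt ->
  tm_step (cfg q t0 t1 t2) =
  let: (q', a0, a1, a2) :=
    ginv_delta q (tape_head t0) (tape_head t1) (tape_head t2) in
  cfg q' (tape_act a0 t0) (tape_act a1 t1) (tape_act a2 t2).
Proof.
move=> q_run; rewrite /tm_step /= (negbTE q_run) !ffunE !inordK //=.
case: (ginv_delta q _ _ _) => [[[q' a0] a1] a2]; congr (_, _); apply/ffunP=> i.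
by rewrite !ffunE; case: i => -[|[|[|]]].
Qed.

(** Upper bounds suffice, since a halted machine stays put. *)
Definition reaches t (c c' : config ginv_machine) : Prop :=
  exists2 k, k <= t & iter k (@tm_step ginv_machine) c = c'.

Lemma reaches_refl t c : reaches t c c.
Proof. by exists 0. Qed.

Lemma reaches_trans t1 t2 c1 c2 c3 :
  reaches t1 c1 c2 -> reaches t2 c2 c3 -> reaches (t1 + t2) c1 c3.
Proof.
case=> k1 le1 <- [k2 le2 <-]; exists (k2 + k1); last by rewrite iterD.
by rewrite addnC leq_add.
Qed.

Lemma reaches_leq t t' c c' : t <= t' -> reaches t c c' -> reaches t' c c'.
Proof. by move=> le_tt' [k le_kt <-]; exists k => //; apply: leq_trans le_kt _. Qed.

Lemma reaches_step t q t0 t1 t2 c : q != Halt ->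
  reaches t (let: (q', a0, a1, a2) :=
    ginv_delta q (tape_head t0) (tape_head t1) (tape_head t2) in
    cfg q' (tape_act a0 t0) (tape_act a1 t1) (tape_act a2 t2)) c ->
  reaches t.+1 (cfg q t0 t1 t2) c.
Proof.
move=> q_run; rewrite -step_cfg // => -[k le_kt <-].
by exists k.+1 => //; rewrite iterSr.
Qed.

(* The head of [tape_from l s] scans the first symbol of [s]; that of
   [tape_upto l r] scans the first symbol of [l]. *)
Definition tape_from (l s : seq sym) : gtape := Tape l (head None s) (behead s).
Definition tape_upto (l r : seq sym) : gtape := Tape (behead l) (head None l) r.

Definition counter_cells (d : seq bool) k : seq sym := map bit d ++ nseq k filler.

Lemma tape_act_stay t : tape_act (tape_head t, Stay) t = t.
Proof. by case: t. Qed.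

Lemma reaches_sweep f c t0 t2 l d k :
  reaches (size d + k).+1
    (cfg (Sweep f c) t0 (tape_from l (counter_cells d k)) t2)
    (cfg (Back f (c && all id d)) t0
      (tape_upto (catrev (counter_cells (add_carry c d) k) l) [:: filler]) t2).
Proof.
elim: d c l => [|b d IHd] c l.
  rewrite /counter_cells /= andbT add0n; elim: k l => [|k IHk] l.
    by apply: reaches_step => //=; rewrite !tape_act_stay; apply: reaches_refl.
  by apply: reaches_step => //=; rewrite !tape_act_stay; apply: IHk.
rewrite /= andbA; apply: reaches_step => //=; rewrite !tape_act_stay.
exact: IHd.
Qed.

Definition refill (m : bool) (x : sym) : sym :=
  if x is Some (inr _) then if m then bit false else x else x.

Lemma reaches_back f m t0 t2 l r : all isSome l ->
  reaches (size l)
    (cfg (Back f m) t0 (tape_upto (l ++ [:: None]) r) t2)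
    (cfg (Back f m) t0 (tape_upto [:: None] (catrev (map (refill m) l) r)) t2).
Proof.
elim: l r => [|x l IHl] r; first by move=> _; apply: reaches_refl.
by case: x => //= x all_l; apply: reaches_step => //=;
  case: x => [b|[]]; rewrite /= !tape_act_stay; apply: IHl.
Qed.

Lemma all_counter_cells d k : all isSome (counter_cells d k).
Proof. by rewrite all_cat; apply/andP; split; [elim: d | elim: k]. Qed.

Lemma map_refill_cells m d k : map (refill m) (counter_cells d k) =
  counter_cells (if m then d ++ nseq k false else d) (if m then 0 else k).
Proof.
rewrite /counter_cells map_cat -map_comp (eq_map (_ : _ =1 bit)) // map_nseq.
by case: m => //=; rewrite map_cat map_nseq cats0.
Qed.

Lemma reaches_read f s b w l d k t2 :
  let c := ~~ s && all id d in
  let f' := if b == c then f else c in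
  reaches (2 * (size d + k) + 3)
    (cfg (Read f s) (tape_from l (bit b :: w)) (tape_from [:: None] (counter_cells d k)) t2)
    (cfg (if c then Incr f' true else Read f' false) (tape_from (None :: l) w)
       (tape_from [:: None] (counter_cells
          (if c then add_carry (~~ s) d ++ nseq k false else add_carry (~~ s) d)
          (if c then 1 else k.+1))) t2).
Proof.
move=> c f'; have -> : 2 * (size d + k) + 3 = (((size d + k).+1 + (size d + k)) + 1).+1 by lia.
apply: reaches_step => //=; rewrite !tape_act_stay -/(bit b).
apply: reaches_trans (reaches_trans (reaches_sweep _ _ _ _ _ _ _) _) _.
  rewrite catrevE.
  have := @reaches_back f c (tape_from l (bit b :: w)) t2
    (rev (counter_cells (add_carry (~~ s) d) k)) [:: filler].
  rewrite all_rev all_counter_cells size_rev => /(_ isT); apply: reaches_leq.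
  by rewrite size_cat size_map size_nseq size_add_carry.
apply: reaches_step => //=; rewrite !tape_act_stay -/c -/f'.
rewrite catrevE -map_rev revK map_refill_cells.
(* The filler written at the end of the sweep lies to the right of the head on its way back, so it
   survives an overflow. *)
have -> : counter_cells
      (if c then add_carry (~~ s) d ++ nseq k false else add_carry (~~ s) d)
      (if c then 0 else k) ++ [:: filler] =
    counter_cells
      (if c then add_carry (~~ s) d ++ nseq k false else add_carry (~~ s) d)
      (if c then 1 else k.+1).
  rewrite /counter_cells -catA; congr (_ ++ _); case: c {f'} => //.
  by rewrite cats1 -[k.+1]addn1 nseqD cats1.
exact: reaches_refl.
Qed.

Lemma reaches_incr f s t0 t1 l e :
  exists ls r, [/\ all isSome ls, size ls <= size e,
    catrev ls r = map bit (add_bit true e) &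
    reaches (size e).+1
      (cfg (Incr f s) t0 t1 (tape_from l (map bit e)))
      (cfg (Rewind f s) t0 t1 (tape_upto (ls ++ l) r))].
Proof.
elim: e l => [|[] e IHe] l.
- exists [::], [:: bit true]; split=> //.
  by apply: reaches_step => //=; rewrite !tape_act_stay; apply: reaches_refl.
- have [ls [r [all_ls sz_ls cat_ls run]]] := IHe (bit false :: l).
  exists (rcons ls (bit false)), r; split.
  + by rewrite all_rcons.
  + by rewrite size_rcons.
  + by rewrite catrevE rev_rcons /= -catrevE cat_ls.
  apply: reaches_step => //=; rewrite !tape_act_stay cat_rcons; exact: run.
exists [::], (bit true :: map bit e); rewrite /= add_bit0; split=> //.
by apply: reaches_step => //=; rewrite !tape_act_stay; apply: reaches_refl.
Qed.

Lemma reaches_rewind f s t0 t1 l r : all isSome l ->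
  reaches (size l).+1
    (cfg (Rewind f s) t0 t1 (tape_upto (l ++ [:: None]) r))
    (cfg (Read f s) t0 t1 (tape_from [:: None] (catrev l r))).
Proof.
elim: l r => [|x l IHl] r.
  by move=> _; apply: reaches_step => //=; rewrite !tape_act_stay; apply: reaches_refl.
by case: x => //= x all_l; apply: reaches_step => //=; rewrite !tape_act_stay; apply: IHl.
Qed.

Lemma reaches_count f s t0 t1 D :
  reaches (2 * size (binary D) + 2)
    (cfg (Incr f s) t0 t1 (tape_from [:: None] (map bit (binary D))))
    (cfg (Read f s) t0 t1 (tape_from [:: None] (map bit (binary D.+1)))).
Proof.
have [ls [r [all_ls sz_ls cat_ls run]]] := reaches_incr f s t0 t1 [:: None] (binary D).
have := reaches_trans run (reaches_rewind f s t0 t1 r all_ls).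
rewrite cat_ls -binary_add_bit addn1; apply: reaches_leq.
by lia.
Qed.

(** The counter region has [p] cells and [D] is at most [p.+1], so each bit costs time linear in
    [N]. Input cells are erased once read, which makes room for the output. *)
Lemma reaches_scan N w p D d k s f v : scan_inv p D d k s f v ->
  p + size w <= N ->
  exists D' d' k' s' f', scan_inv (p + size w) D' d' k' s' f' (v + 2 ^ p * bits_val w) /\
  reaches (size w * (4 * N + 8))
    (cfg (Read f s) (tape_from (nseq p None) (map bit w))
      (tape_from [:: None] (counter_cells d k))
      (tape_from [:: None] (map bit (binary D))))
    (cfg (Read f' s') (tape_from (nseq (p + size w) None) [::])
      (tape_from [:: None] (counter_cells d' k'))
      (tape_from [:: None] (map bit (binary D')))).
Proof.
elim: w p D d k s f v => [|b w IHw] p D d k s f v inv leN.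
  exists D, d, k, s, f; rewrite muln0 !addn0; split=> //; exact: reaches_refl.
have := scan_inv_step b inv; set c := ~~ s && all id d => inv1.
have [|D' [d' [k' [s' [f' [inv' run]]]]]] := IHw _ _ _ _ _ _ _ inv1.
  by move: leN; rewrite /= addnS addSn.
exists D', d', k', s', f'; split.
  rewrite [size _]/= addnS -addSn.
  suff -> : v + 2 ^ p * bits_val (b :: w) = v + b * 2 ^ p + 2 ^ p.+1 * bits_val w by [].
  by rewrite /= mulnDr expnS mulnCA mulnA; lia.
have -> : p + size (b :: w) = p.+1 + size w by rewrite /= addSn addnS.
rewrite [size _]/= mulSn; apply: reaches_trans run.
case: inv => /andP[_ leD] rng [szd kE] _ _.
have pE : size d + k = p.
  rewrite szd kE; move: rng; case: eqP => [-> ->//|_]; lia.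
have := @reaches_read f s b (map bit w) (nseq p None) d k
  (tape_from [:: None] (map bit (binary D))).
rewrite -/c pE => run1; move: leN; rewrite /= => leN.
case: (boolP c) run1 => c1 run1; last first.
  by rewrite addn0; apply: reaches_leq run1; lia.
have := reaches_trans run1 (reaches_count _ _ _ _ _); rewrite addn1; apply: reaches_leq.
have := size_binary_leq D; lia.
Qed.

Lemma reaches_final c t0 t1 l e : exists r,
  reaches (size e).+1
    (cfg (Final c) t0 t1 (tape_from l (map bit e)))
    (cfg Output t0 t1 (tape_upto (catrev (map bit (add_bit c e)) l) r)).
Proof.
elim: e c l => [|b e IHe] c l.
  case: c; [exists [::] | exists [:: None]];
    by apply: reaches_step => //=; rewrite !tape_act_stay; apply: reaches_refl.
have [r run] := IHe (c && b) (bit (c (+) b) :: l); exists r.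
by apply: reaches_step => //=; rewrite !tape_act_stay; apply: run.
Qed.

(** Copying from the most significant digit makes the output grow leftwards over blanks; the last
    move puts the head on its first digit. *)
Lemma reaches_output p t1 l r o : all isSome l ->
  exists p' t2, reaches (size l).+1
    (cfg Output (tape_upto (nseq p None) o) t1 (tape_upto (l ++ [:: None]) r))
    (cfg Halt (tape_from (nseq p' None) (catrev l o)) t1 t2).
Proof.
have headN q : head None (nseq q (None : sym)) = None by case: q.
have beheadN q : behead (nseq q (None : sym)) = nseq q.-1 None by case: q.
elim: l p r o => [|x l IHl] p r o.
  move=> _; eexists p.-1.+1, _; apply: reaches_step => //=.
  by rewrite !tape_act_stay /tape_act /= headN beheadN; apply: reaches_refl.
case: x => //= x all_l; have [p' [t2 run]] := IHl p.-1 (Some x :: r) (Some x :: o) all_l.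
exists p', t2; apply: reaches_step => //=; rewrite !tape_act_stay.
by rewrite /tape_act /= beheadN; apply: run.
Qed.

Lemma initial_cfg w : initial_config ginv_machine w =
  cfg Start (tape_from [::] (map bit w)) (tape_from [::] [::]) (tape_from [::] [::]).
Proof.
rewrite /initial_config; congr (_, _); apply/ffunP=> i; rewrite !ffunE.
by case: i => -[|[|[|]]].
Qed.

Lemma leading_bits_map e : leading_bits (map bit e) = e.
Proof. by elim: e => //= b e ->. Qed.

Lemma tm_halt_iter t c : tm_halt c.1 -> iter t (@tm_step ginv_machine) c = c.
Proof. by move=> halt; elim: t => //= t ->; rewrite /tm_step halt. Qed.

Lemma ginv_polytime : polytime_computable ginv.
Proof.
exists ginv_machine, 64, 2 => n; set N := size (binary n).
have inv0 : scan_inv 0 1 [::] 0 false true 0 by [].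
have [D [d [k [s [f [inv run]]]]]] := reaches_scan inv0 (leqnn (0 + N)).
have [vn _] := binaryP n.
move: inv run; rewrite !add0n expn0 mul1n vn => inv run.
have gE := ginv_scan inv.
case: inv => /andP[_ leD] _ _ _ _.
pose t1 := tape_from [:: None] (counter_cells d k).
have [r runF] := reaches_final (~~ f) (tape_from (nseq N None) [::]) t1 [:: None] (binary D).
move: runF; rewrite -binary_add_bit -gE catrevE => runF.
(* [N.+1] counts the scanned blank together with the [N] blanks to its left. *)
have [|p' [t2 runO]] := @reaches_output N.+1 t1 (rev (map bit (binary (ginv n)))) r [::].
  by rewrite all_rev all_map; apply/allP.
have {}runO : reaches (size (binary (ginv n))).+1
   (cfg Output (tape_from (nseq N None) [::]) t1
     (tape_upto (rev (map bit (binary (ginv n))) ++ [:: None]) r))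
   (cfg Halt (tape_from (nseq p' None) (map bit (binary (ginv n)))) t1 t2).
  by move: runO; rewrite size_rev size_map catrevE revK cats0.
have runR : reaches 1 (cfg (Read f s) (tape_from (nseq N None) [::]) t1
      (tape_from [:: None] (map bit (binary D))))
   (cfg (Final (~~ f)) (tape_from (nseq N None) [::]) t1
      (tape_from [:: None] (map bit (binary D)))).
  by apply: reaches_step => //=; apply: reaches_refl.
have runS : reaches 3 (initial_config ginv_machine (binary n))
    (cfg (Read true false) (tape_from [::] (map bit (binary n)))
      (tape_from [:: None] [::]) (tape_from [:: None] (map bit (binary 1)))).
  rewrite initial_cfg; apply: reaches_step => //=.
  (* The blank tape is the word of 0, so the first increment sets [D] to 1. *)
  exact: (reaches_count true false _ _ 0).
have [K leK runK] := reaches_trans runS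
  (reaches_trans run (reaches_trans runR (reaches_trans runF runO))).
have sz1 := size_binary_leq D; have sz2 := size_binary_leq (ginv n).
have leT : K <= 64 * N ^ 2 + 64.
  apply: leq_trans leK _; have : ginv n <= N.+2 by rewrite gE; case: (f); lia.
  by rewrite -/N expnS expn1; nia.
rewrite /tm_computes_within -(subnK leT) iterD runK tm_halt_iter //.
split=> //; rewrite ffunE /=; case: (binary (ginv n)) => //= b e.
by rewrite /tape_output /= leading_bits_map.
Qed.

Theorem theorem3p3 :
  (forall h : nat,
     persistent_price_is (pyramid h) (h + ginv h) /\
     persistent_price_is (binary_tree h) (h + ginv h)) /\
  polytime_computable ginv.
Proof. by split; [apply: pebbling_prices | apply: ginv_polytime]. Qed.
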